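(* Let $\Omega\subseteq\mathbb{R}^n$ be open, $\nu,C_1,\dots,C_{n-1}\in\mathcal{C}^\infty(\Omega,\mathbb{R})$, $H:=C_{n-1}$, and $X$ the vector field on $\Omega$ with components $X_i=\nu\cdot\frac{\partial(C_1,\dots,C_{n-2},x_i,H)}{\partial(x_1,\dots,x_n)}$. Let $\overline{x}_e\in\mathcal{E}^{C_{n-1}}_{C_1,\dots,C_{n-2}}$ be a non-degenerate regular equilibrium point of $X$, with associated multiplier vector $\overrightarrow{\lambda_e}\in\mathbb{R}^{n-2}$. Then there exist an open neighborhood $V\subseteq\mathbb{R}^{n-2}$ of $\overrightarrow{\lambda_e}$, an open neighborhood $U\subseteq\Omega$ of $\overline{x}_e$, and a smooth map $\overline{x}:V\to U$ with $\overline{x}(\overrightarrow{\lambda_e})=\overline{x}_e$ such that for every $\overrightarrow{\lambda}\in V$, $\overline{x}(\overrightarrow{\lambda})\in\mathcal{E}^{C_{n-1}}_{C_1,\dots,C_{n-2}}\cap U$ is a non-degenerate regular equilibrium point of $X$.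
   Context: $\nabla$ is the gradient for the standard inner product; $\frac{\partial(\cdots)}{\partial(x_1,\dots,x_n)}$ is a Jacobian determinant. $\mathcal{E}^{C_{n-1}}_{C_1,\dots,C_{n-2}}:=\{\overline{x}\in\Omega:\nu(\overline{x})\neq0,\ \nabla C_1\wedge\dots\wedge\nabla C_{n-2}(\overline{x})\neq0,\ \nabla C_1\wedge\dots\wedge\nabla C_{n-1}(\overline{x})=0\}$ (regular equilibria). For $\overline{x}\in\mathcal{E}^{C_{n-1}}_{C_1,\dots,C_{n-2}}$ there is a unique $\overrightarrow{\lambda}=(\lambda_1,\dots,\lambda_{n-2})\in\mathbb{R}^{n-2}$ with $\nabla H(\overline{x})+\sum_i\lambda_i\nabla C_i(\overline{x})=0$ (for $\overline{x}_e$ this is $\overrightarrow{\lambda_e}$); with $F_{\overrightarrow{\lambda}}:=H+\sum_i\lambda_iC_i$, the point $\overline{x}$ is called non-degenerate if $\det\operatorname{Hess}F_{\overrightarrow{\lambda}}(\overline{x})\neq0$, where $\operatorname{Hess}F(\overline{x})=\mathrm{D}(\nabla F)(\overline{x})$. *)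

(* Defs.v *)
From HB Require Import structures.
From mathcomp Require Import all_boot all_order all_algebra.
From mathcomp Require Import all_classical all_reals all_analysis.
Set Implicit Arguments. Unset Strict Implicit. Unset Printing Implicit Defensive.
Import Order.TTheory GRing.Theory Num.Theory.
Import numFieldNormedType.Exports.
Local Open Scope classical_set_scope.
Local Open Scope ring_scope.

Section Defs.
Variable R : realType.

Definition evec (n : nat) (i : 'I_n) : 'rV[R]_n := delta_mx 0 i.

Definition partial (n : nat) (i : 'I_n) (f : 'rV[R]_n -> R) : 'rV[R]_n -> R :=
  fun x => 'D_(evec i) f x.

Definition grad (n : nat) (f : 'rV[R]_n -> R) (x : 'rV[R]_n) : 'rV[R]_n :=
  \row_i partial i f x.

Definition hess (n : nat) (f : 'rV[R]_n -> R) (x : 'rV[R]_n) : 'M[R]_n :=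
  \matrix_(i, j) partial j (partial i f) x.

Fixpoint Ck (n : nat) (k : nat) (A : set 'rV[R]_n) (f : 'rV[R]_n -> R) : Prop :=
  match k with
  | 0 => forall x, A x -> {for x, continuous f}
  | k'.+1 => (forall x, A x -> differentiable f x) /\
             (forall i : 'I_n, Ck k' A (partial i f))
  end.

Definition smooth (n : nat) (A : set 'rV[R]_n) (f : 'rV[R]_n -> R) : Prop :=
  forall k, Ck k A f.

Definition smooth_map (m n : nat) (A : set 'rV[R]_m) (g : 'rV[R]_m -> 'rV[R]_n)
  : Prop := forall j : 'I_n, smooth A (fun l => g l 0 j).

(* v_1 /\ ... /\ v_k = 0 (rows of M): all coordinates of the wedge in the
   basis e_{j_1} /\ ... /\ e_{j_k}, i.e. all k x k minors, vanish *)
Definition wedge_eq0 (k n : nat) (M : 'M[R]_(k, n)) : Prop :=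
  forall f : 'I_k -> 'I_n, \det (colsub f M) = 0.

Definition gradsC (m n : nat) (C : 'I_m -> 'rV[R]_n -> R) (x : 'rV[R]_n)
  : 'M[R]_(m, n) := \matrix_(k, l) grad (C k) x 0 l.

(* Jacobian matrix of (C_1,...,C_m, x_i, H) w.r.t. (x_1,...,x_{m+2}) *)
Definition jacX (m : nat) (C : 'I_m -> 'rV[R]_m.+2 -> R) (H : 'rV[R]_m.+2 -> R)
  (i : 'I_m.+2) (x : 'rV[R]_m.+2) : 'M[R]_(m.+2) :=
  castmx (addn2 m, erefl m.+2)
    (col_mx (gradsC C x) (col_mx (evec i) (grad H x))).

Definition vfX (m : nat) (nu : 'rV[R]_m.+2 -> R) (C : 'I_m -> 'rV[R]_m.+2 -> R)
  (H : 'rV[R]_m.+2 -> R) (x : 'rV[R]_m.+2) : 'rV[R]_m.+2 :=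
  \row_i (nu x * \det (jacX C H i x)).

Definition regEq (m : nat) (Omega : set 'rV[R]_m.+2) (nu : 'rV[R]_m.+2 -> R)
  (C : 'I_m -> 'rV[R]_m.+2 -> R) (H : 'rV[R]_m.+2 -> R) : set 'rV[R]_m.+2 :=
  [set x | Omega x /\ nu x != 0 /\ ~ wedge_eq0 (gradsC C x)
           /\ wedge_eq0 (col_mx (gradsC C x) (grad H x))].

Definition Flam (m n : nat) (C : 'I_m -> 'rV[R]_n -> R) (H : 'rV[R]_n -> R)
  (lam : 'rV[R]_m) : 'rV[R]_n -> R :=
  fun x => H x + \sum_(i < m) lam 0 i * C i x.

Definition is_multiplier (m n : nat) (C : 'I_m -> 'rV[R]_n -> R)
  (H : 'rV[R]_n -> R) (lam : 'rV[R]_m) (x : 'rV[R]_n) : Prop :=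
  grad H x + \sum_(i < m) lam 0 i *: grad (C i) x = 0.

Definition nondeg (m n : nat) (C : 'I_m -> 'rV[R]_n -> R) (H : 'rV[R]_n -> R)
  (lam : 'rV[R]_m) (x : 'rV[R]_n) : Prop :=
  \det (hess (Flam C H lam) x) != 0.

End Defs.

(* Main.v *)
Require Import Defs.
From HB Require Import structures.
From mathcomp Require Import all_boot all_order all_algebra.
From mathcomp Require Import all_classical all_reals all_analysis.
From mathcomp Require Import ring lra.
Import Order.TTheory GRing.Theory Num.Theory.
Import numFieldNormedType.Exports.
Local Open Scope classical_set_scope.
Local Open Scope ring_scope.

(* The multiplier equation grad H + sum_a l_a grad C_a = 0 is affine in l, and its
   Jacobian in x is the Hessian of F_l, invertible at (lame, xe).  For l near
   lame, the Newton-type map x |-> x - (grad F_l)(x) B, with B the inverse of the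
   Jacobian at (lame, xe), is a contraction of a small ball; its fixed point
   xbar l is Lipschitz in l, hence differentiable, and the formula for the
   partial derivatives of xbar expresses them through xbar itself, so that
   xbar is C^k for all k by induction.  The multiplier equation makes the
   gradients dependent, so xbar l is an equilibrium; the conditions nu <> 0 and
   grad C_1 /\ ... /\ grad C_m <> 0 are open. *)

Set Implicit Arguments. Unset Strict Implicit. Unset Printing Implicit Defensive.

(** * Differentiability through epsilon estimates *)

Lemma differentiable_epsP (R : realType) (V W : normedModType R) (f : V -> W) x
    (df : {linear V -> W}) : continuous df ->
  (forall e, 0 < e -> \forall y \near x, `|f y - f x - df (y - x)| <= e * `|y - x|) ->
  is_diff x f df.
Proof.
move=> cdf fdf.
have E : f \o shift x = cst (f x) + df +o_ (0 : V) id.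
  apply/eqaddoP => e e0; have := fdf e e0.
  rewrite (near_shift 0 x) => /=.
  apply: filterS => h; rewrite /= subr0 addrK.
  by rewrite -![(_ + _ : _ -> _) _]/(_ + _) -![(- _ : _ -> _) _]/(- _) /= opprD addrA.
(* The estimate is the little-o expansion [E]; uniqueness of the differential then identifies [df]
   with ['d f x]. *)
have D := diff_unique cdf E.
by apply: DiffDef => //; apply/diff_locallyP; rewrite D.
Qed.

Lemma differentiable_eps (R : realType) (V W : normedModType R) (f : V -> W) x e :
  differentiable f x -> 0 < e ->
  \forall y \near x, `|f y - f x - 'd f x (y - x)| <= e * `|y - x|.
Proof.
move=> /diff_locally/eqaddoP fx e0; have := fx e e0.
rewrite (near_shift 0 x).
apply: filterS => h; rewrite /= subr0 addrK.
by rewrite -![(_ + _ : _ -> _) _]/(_ + _) -![(- _ : _ -> _) _]/(- _) /= opprD addrA.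
Qed.

Lemma near_eq_differentiable (R : realType) (V W : normedModType R) (f g : V -> W) x :
  (\forall y \near x, f y = g y) -> differentiable f x -> differentiable g x.
Proof.
move=> fg dfx; have fgx := nbhs_singleton fg.
suff [] : is_diff x g ('d f x) by [].
apply: (@differentiable_epsP _ _ _ g x ('d f x)); first exact: diff_continuous.
move=> e e0; have := differentiable_eps dfx e0.
apply: filterS2 fg => y fgy.
by rewrite fgy fgx.
Qed.

(** * Rules for partial derivatives *)

Section PartialCalculus.
Variables (R : realType) (m n : nat).
Implicit Types (f g : 'rV[R]_n -> R) (A : set 'rV[R]_n).

Lemma near_eq_partial (i : 'I_n) f g x :
  (\forall y \near x, f y = g y) -> partial i f x = partial i g x.
Proof. exact: near_eq_derive. Qed.

Lemma partialD (i : 'I_n) f g x : differentiable f x -> differentiable g x ->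
  partial i (fun y => f y + g y) x = partial i f x + partial i g x.
Proof. by move=> df dg; apply: deriveD; exact: diff_derivable. Qed.

Lemma partialM (i : 'I_n) f g x : differentiable f x -> differentiable g x ->
  partial i (fun y => f y * g y) x = f x * partial i g x + g x * partial i f x.
Proof. by move=> df dg; apply: deriveM; exact: diff_derivable. Qed.

Lemma partialV (i : 'I_n) f x : f x != 0 -> differentiable f x ->
  partial i (fun y => (f y)^-1) x = - (f x)^-1 * (f x)^-1 * partial i f x.
Proof.
move=> f0 df; rewrite /partial deriveV//; last exact: diff_derivable.
by rewrite -exprVn expr2 mulNr.
Qed.

Lemma partial_cst (i : 'I_n) (c : R) (x : 'rV[R]_n) : partial i (fun=> c) x = 0.
Proof. exact: derive_cst. Qed.

Lemma partial_coord (i j : 'I_n) (x : 'rV[R]_n) :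
  partial i (fun y : 'rV[R]_n => y 0 j) x = (j == i)%:R.
Proof.
have := derive_mx (@derivable_id _ _ x (evec R i)).
rewrite derive_id => /rowP/(_ j); rewrite [RHS]mxE /partial => <-.
by rewrite mxE.
Qed.

Lemma differentiable_row (V : normedModType R) (h : V -> 'rV[R]_n) x :
  (forall j, differentiable (fun y => h y 0 j) x) -> differentiable h x.
Proof.
move=> dh; have -> : h = \sum_(j < n) (fun y => h y 0 j *: 'e_j).
  by apply/funext => y; rewrite fct_sumE [LHS]row_sum_delta.
by apply: differentiable_sum => j; exact: differentiableZl.
Qed.

Lemma diff_partial f x (v : 'rV[R]_n) : differentiable f x ->
  'd f x v = \sum_(j < n) v 0 j * partial j f x.
Proof.
move=> df; rewrite [v in LHS]row_sum_delta linear_sum.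
by apply: eq_bigr => j _; rewrite linearZ /partial deriveE.
Qed.

(** Differentials compose; expanding ['d f] along the basis turns the composite into the sum over
    intermediate coordinates. *)
Lemma partial_comp (i : 'I_m) f (h : 'rV[R]_m -> 'rV[R]_n) x :
  (forall j, differentiable (fun y => h y 0 j) x) -> differentiable f (h x) ->
  partial i (fun y => f (h y)) x =
  \sum_(j < n) partial i (fun y => h y 0 j) x * partial j f (h x).
Proof.
move=> dhj df; have dh := differentiable_row dhj.
rewrite /partial deriveE; last exact: differentiable_comp.
rewrite diff_comp//= diff_partial// -deriveE// derive_mx; last exact: diff_derivable.
by apply: eq_bigr => j _; rewrite mxE.
Qed.

End PartialCalculus.

Lemma continuous_mx (R : realType) (T : topologicalType) m n (h : T -> 'M[R]_(m, n)) x :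
  (forall i j, {for x, continuous (fun y => h y i j)}) -> {for x, continuous h}.
Proof.
move=> ch; apply/cvg_ballP => e e0.
have /filter_forall : forall i, \forall y \near x, forall j, ball (h x i j) e (h y i j).
  by move=> i; apply: filter_forall => j; have /cvg_ballP/(_ e e0) := ch i j.
by apply: filterS.
Qed.

(** * Closure properties of functions of class C^k on an open set *)

Section CkCalculus.
Variable R : realType.

Section Algebra.
Variables (n : nat) (A : set 'rV[R]_n).
Hypothesis openA : open A.
Implicit Types f g : 'rV[R]_n -> R.

(** Openness of [A] turns equality on [A] into equality near each of its points, hence into equality
    of partial derivatives. In the inductions below this replaces a partial derivative by a formula
    that holds only on [A]. *)
Lemma Ck_ext k f g : (forall x, A x -> f x = g x) -> Ck k A f -> Ck k A g.
Proof.
have nearA h1 h2 x : (forall x, A x -> h1 x = h2 x) -> A x ->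
    \forall y \near x, h1 y = h2 y :> R.
  by move=> h12 Ax; apply: filterS h12 _; exact: open_nbhs_nbhs.
elim: k f g => [|k IH] f g fg /=.
  move=> cf x Ax; have := cf x Ax.
  rewrite /prop_for /continuous_at fg// => cfx.
  apply: cvg_trans cfx; exact: (@near_eq_cvg _ _ (nbhs x)) (nearA _ _ _ _ Ax).
move=> [df pf]; split.
  by move=> x Ax; apply: near_eq_differentiable (df x Ax); exact: nearA.
move=> i; apply: IH (pf i) => x Ax; apply: near_eq_partial; exact: nearA.
Qed.

Lemma CkW k f : Ck k.+1 A f -> Ck k A f.
Proof.
elim: k f => [|k IH] f [df pf].
  by move=> x Ax; apply: differentiable_continuous; exact: df.
by split=> // i; apply: IH; exact: pf.
Qed.

Lemma Ck_cst k c : Ck k A (fun=> c).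
Proof.
elim: k c => [|k IH] c; first by move=> x _; exact: cst_continuous.
split=> [x _|i]; first exact: differentiable_cst.
by apply: Ck_ext (IH 0) => x _; rewrite partial_cst.
Qed.

Lemma Ck_coord k (j : 'I_n) : Ck k A (fun x => x 0 j).
Proof.
case: k => [|k]; first by move=> x _; exact: coord_continuous.
split=> [x _|i]; first exact: differentiable_coord.
by apply: Ck_ext (Ck_cst k (j == i)%:R) => x _; rewrite partial_coord.
Qed.

Lemma CkD k f g : Ck k A f -> Ck k A g -> Ck k A (fun x => f x + g x).
Proof.
elim: k f g => [|k IH] f g.
  by move=> cf cg x Ax; apply: continuousD; [exact: cf|exact: cg].
move=> [df pf] [dg pg]; split=> [x Ax|i].
  by apply: differentiableD; [exact: df|exact: dg].
apply: Ck_ext (IH _ _ (pf i) (pg i)) => x Ax.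
by rewrite partialD//; [exact: df|exact: dg].
Qed.

Lemma CkM k f g : Ck k A f -> Ck k A g -> Ck k A (fun x => f x * g x).
Proof.
elim: k f g => [|k IH] f g.
  by move=> cf cg x Ax; apply: continuousM; [exact: cf|exact: cg].
move=> /[dup] /CkW cf [df pf] /[dup] /CkW cg [dg pg]; split=> [x Ax|i].
  by apply: differentiableM; [exact: df|exact: dg].
apply: Ck_ext (CkD (IH _ _ cf (pg i)) (IH _ _ cg (pf i))) => x Ax.
by rewrite partialM//; [exact: df|exact: dg].
Qed.

Lemma CkN k f : Ck k A f -> Ck k A (fun x => - f x).
Proof.
move=> cf; apply: Ck_ext (CkM (Ck_cst k (-1)) cf) => x _.
by rewrite mulN1r.
Qed.

(** The derivative of the inverse is a product of inverses with a partial of [f], so the induction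
    hypothesis on the inverse itself closes the step. *)
Lemma CkV k f : (forall x, A x -> f x != 0) -> Ck k A f ->
  Ck k A (fun x => (f x)^-1).
Proof.
move=> f0; elim: k => [|k IH].
  by move=> cf x Ax; apply: continuousV; [exact: f0|exact: cf].
move=> /[dup] /CkW/IH cV [df pf]; split=> [x Ax|i].
  by apply: differentiableV; [exact: df|exact: f0].
apply: Ck_ext (CkM (CkM (CkN cV) cV) (pf i)) => x Ax.
by rewrite partialV//; [exact: f0|exact: df].
Qed.

Lemma Ck_sum k (I : Type) (r : seq I) (P : pred I) (F : I -> 'rV[R]_n -> R) :
  (forall i, P i -> Ck k A (F i)) -> Ck k A (fun x => \sum_(i <- r | P i) F i x).
Proof.
move=> cF; elim: r => [|i r IH].
  by apply: Ck_ext (Ck_cst k 0) => x _; rewrite big_nil.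
have [Pi|nPi] := boolP (P i).
  by apply: Ck_ext (CkD (cF i Pi) IH) => x _; rewrite big_cons Pi.
by apply: Ck_ext IH => x _; rewrite big_cons (negPf nPi).
Qed.

Lemma Ck_prod k (I : Type) (r : seq I) (P : pred I) (F : I -> 'rV[R]_n -> R) :
  (forall i, P i -> Ck k A (F i)) -> Ck k A (fun x => \prod_(i <- r | P i) F i x).
Proof.
move=> cF; elim: r => [|i r IH].
  by apply: Ck_ext (Ck_cst k 1) => x _; rewrite big_nil.
have [Pi|nPi] := boolP (P i).
  by apply: Ck_ext (CkM (cF i Pi) IH) => x _; rewrite big_cons Pi.
by apply: Ck_ext IH => x _; rewrite big_cons (negPf nPi).
Qed.

Lemma Ck_det k q (M : 'rV[R]_n -> 'M[R]_q) :
  (forall i j, Ck k A (fun x => M x i j)) -> Ck k A (fun x => \det (M x)).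
Proof.
move=> cM; rewrite /determinant.
by apply: Ck_sum => s _; apply: CkM; [exact: Ck_cst|exact: Ck_prod].
Qed.

(** By Cramer's formula the entries are cofactors, polynomial in the entries of [M], divided by a
    determinant that does not vanish on [A]. *)
Lemma Ck_invmx k q (M : 'rV[R]_n -> 'M[R]_q) :
  (forall x, A x -> M x \in unitmx) ->
  (forall i j, Ck k A (fun x => M x i j)) ->
  forall i j, Ck k A (fun x => invmx (M x) i j).
Proof.
move=> uM cM i j.
have cadj : Ck k A (fun x => cofactor (M x) j i).
  apply: CkM; first exact: Ck_cst.
  apply: Ck_det => a b; apply: Ck_ext (cM (lift j a) (lift i b)) => x _.
  by rewrite !mxE.
have cV : Ck k A (fun x => (\det (M x))^-1).
  by apply: CkV (Ck_det cM) => x /uM; rewrite unitmxE unitfE.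
apply: Ck_ext (CkM cV cadj) => x Ax.
by rewrite /invmx uM// !mxE.
Qed.

Lemma Ck_mulmx k p q r (M : 'rV[R]_n -> 'M[R]_(p, q)) (N : 'rV[R]_n -> 'M[R]_(q, r)) :
  (forall i j, Ck k A (fun x => M x i j)) ->
  (forall i j, Ck k A (fun x => N x i j)) ->
  forall i j, Ck k A (fun x => (M x *m N x) i j).
Proof.
move=> cM cN i j.
have cMN : Ck k A (fun x => \sum_a M x i a * N x a j) by apply: Ck_sum => a _; exact: CkM.
by apply: Ck_ext cMN => x _; rewrite mxE.
Qed.

End Algebra.

(** Induction on [k] for all [f] at once: the chain rule writes the partials as sums of products of
    partials of [h] with composites [partial j f (h x)], which are of one order less. *)
Lemma Ck_comp m n k (A : set 'rV[R]_m) (B : set 'rV[R]_n) (f : 'rV[R]_n -> R)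
    (h : 'rV[R]_m -> 'rV[R]_n) : open A -> (forall x, A x -> B (h x)) ->
  (forall j, Ck k A (fun x => h x 0 j)) -> Ck k B f -> Ck k A (fun x => f (h x)).
Proof.
move=> oA AB; elim: k f => [|k IH] f.
  move=> ch cf x Ax; apply: continuous_comp; last by apply: cf; exact: AB.
  by apply: continuous_mx => i j; rewrite ord1; exact: ch.
move=> ch [df pf].
have dh x : A x -> forall j, differentiable (fun y => h y 0 j) x.
  by move=> Ax j; have [+ _] := ch j; exact.
split=> [x Ax|i].
  by apply: (@differentiable_comp _ _ _ _ h f);
    [apply: differentiable_row; exact: dh|exact/df/AB].
have cp : Ck k A (fun x => \sum_j partial i (fun y => h y 0 j) x * partial j f (h x)).
  apply: Ck_sum => // j _; apply: CkM => //; first by have [_] := ch j; exact.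
  by apply: IH (pf j) => a; exact/CkW.
by apply: Ck_ext cp => // x Ax; rewrite partial_comp//; [exact: dh|exact/df/AB].
Qed.

End CkCalculus.

(** * The maximum norm on matrices *)

Section MatrixNorm.
Variable R : realType.

Lemma ler_entry_norm m n (M : 'M[R]_(m, n)) i j : `|M i j| <= `|M|.
Proof.
rewrite [leRHS]/Num.Def.normr/= mx_normrE.
exact: (le_bigmax 0 (fun ij => `|M ij.1 ij.2|) (i, j)).
Qed.

Lemma mx_norm_le m n (M : 'M[R]_(m, n)) c :
  0 <= c -> (forall i j, `|M i j| <= c) -> `|M| <= c.
Proof.
by move=> c0 Mc; rewrite [leLHS]/Num.Def.normr/= mx_normrE; apply: bigmax_le.
Qed.

(** The norm is the largest absolute value of an entry, which is not submultiplicative: each entry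
    of the product is a sum of [m] terms, whence the factor [m%:R]. *)
Lemma ler_norm_mulrowmx m n (u : 'rV[R]_m) (M : 'M[R]_(m, n)) :
  `|u *m M| <= m%:R * `|u| * `|M|.
Proof.
apply: mx_norm_le => [|i j]; first by rewrite !mulr_ge0.
rewrite mxE (le_trans (ler_norm_sum _ _ _))//.
rewrite (le_trans (ler_sum _ (G := fun=> `|u| * `|M|) _))//.
  by move=> k _; rewrite normrM ler_pM// ler_entry_norm.
by rewrite sumr_const card_ord -mulrA mulr_natl.
Qed.

Lemma mulmxr_continuous m n (M : 'M[R]_(m, n)) :
  continuous (fun u : 'rV[R]_m => u *m M).
Proof.
apply: (@bounded_linear_continuous _ _ _ (mulmxr M : {linear 'rV[R]_m -> 'rV[R]_n})).
apply/bounded_funP => r; exists (m%:R * r * `|M|) => x xr /=.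
apply: (le_trans (ler_norm_mulrowmx x M)).
by rewrite ler_wpM2r// ler_wpM2l.
Qed.

End MatrixNorm.

(** * Contractions with a parameter and mean value estimates *)

(** Makes row vectors a complete normed module, as the Banach fixed point theorem requires. *)
HB.instance Definition _ (R : realType) m n := Complete.on 'M[R]_(m, n).

(** Banach's theorem applies to each [T p] on the closed ball of radius [r]. Comparing two fixed
    points gives |g p - g q| <= |g p - g q| / 2 + K |p - q|, and absorbing the first term yields the
    constant [2 * K]. *)
Lemma parametric_contraction (R : realType) (P : normedModType R)
    (X : completeNormedModType R) (T : P -> X -> X) p0 x0 (d r K : R) :
  0 < d -> 0 < r -> 0 <= K -> K * d <= r / 2 -> T p0 x0 = x0 ->
  (forall p x y, `|p0 - p| < d -> `|x0 - x| <= r -> `|x0 - y| <= r ->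
    `|T p x - T p y| <= 2^-1 * `|x - y|) ->
  (forall p q x, `|p0 - p| < d -> `|p0 - q| < d -> `|x0 - x| <= r ->
    `|T p x - T q x| <= K * `|p - q|) ->
  exists g : P -> X, [/\ g p0 = x0,
    forall p, `|p0 - p| < d -> `|x0 - g p| <= r /\ T p (g p) = g p &
    forall p q, `|p0 - p| < d -> `|p0 - q| < d -> `|g p - g q| <= 2 * K * `|p - q|].
Proof.
move=> d0 r0 K0 Kd T0 Tx Tp.
have p0d : `|p0 - p0| < d by rewrite subrr normr0.
have x0r : `|x0 - x0| <= r by rewrite subrr normr0 ltW.
pose U : set X := closed_ball_ Num.Def.normr x0 r.
have fixT p : exists x, `|p0 - p| < d -> `|x0 - x| <= r /\ T p x = x.
  (* Outside the parameter ball nothing is claimed, and [x0] serves as a default value. *)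
  have [pd|] := ltP `|p0 - p| d; last by exists x0.
  have TU : set_fun U U (T p).
    move=> x /= xr; rewrite /U /closed_ball_ /=.
    (* Passing through [T p x0] splits the distance from [x0] to [T p x]: moving the parameter costs
       at most [K * d <= r / 2], moving the point at most [r / 2]. *)
    rewrite -{1}T0 -(subrKA (T p x0)) (le_trans (ler_normD _ _))//.
    rewrite (splitr r) lerD//.
      by rewrite (le_trans (Tp _ _ _ _ _ _))// (le_trans _ Kd)// ler_wpM2l// ltW.
    by rewrite (le_trans (Tx _ _ _ _ _ _))// mulrC ler_wpM2r// invr_ge0.
  pose f : {fun U >-> U} := HB.pack (T p) (isFun.Build _ _ U U (T p) TU).
  have fc : is_contraction f.
    exists (2^-1)%:nng; split => /=; first by rewrite invf_lt1 ?ltr1n.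
    by move=> [x y] [/= xr yr]; exact: Tx.
  have [||x xr xE] := banach_fixed_point fc.
  - exact: closed_closed_ball_.
  - by exists x0.
  - by exists x.
have [g gP] := choice fixT.
have gL p q : `|p0 - p| < d -> `|p0 - q| < d -> `|g p - g q| <= 2 * K * `|p - q|.
  move=> pd qd; have [gpr gpE] := gP _ pd; have [gqr gqE] := gP _ qd.
  have := ler_normD (T p (g p) - T p (g q)) (T p (g q) - T q (g q)).
  rewrite subrKA gpE gqE.
  have := Tx _ _ _ pd gpr gqr; have := Tp _ _ _ pd qd gqr.
  rewrite gpE gqE => h1 h2 h3.
  rewrite -mulrA.
  set a := `|g p - g q| in h2 h3 *; set b := K * _ in h1 *.
  lra.
exists g; split=> //.
(* Both [g p0] and [x0] are fixed by [T p0], so their distance is at most half of itself. *)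
have [gr gE] := gP _ p0d.
have := Tx _ _ _ p0d gr x0r; rewrite gE T0.
set a := `|g p0 - x0| => ha.
have : a <= 0 by lra.
by rewrite normr_le0 subr_eq0 => /eqP.
Qed.

(** The one-variable mean value theorem along the segment from [y] to [x], which stays in the ball
    by convexity. *)
Lemma mean_value_row (R : realType) n (f : 'rV[R]_n -> R) (x0 x y : 'rV[R]_n) r :
  (forall z, `|x0 - z| < r -> differentiable f z) ->
  `|x0 - x| < r -> `|x0 - y| < r ->
  exists2 z, `|x0 - z| < r &
    f x - f y = \sum_(i < n) (x - y) 0 i * partial i f z.
Proof.
move=> df xr yr.
pose h (t : R) := y + t *: (x - y).
have hr t : 0 <= t <= 1 -> `|x0 - h t| < r.
  move=> /andP[t0 t1].
  have -> : x0 - h t = (1 - t) *: (x0 - y) + t *: (x0 - x).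
    rewrite /h scalerBl scale1r !scalerBr !opprD !addrA; apply/rowP => i.
    by rewrite !mxE; ring.
  rewrite (le_lt_trans (ler_normD _ _))// !normrZ !ger0_norm ?subr_ge0//.
  move: xr yr; set a := `|x0 - x|; set b := `|x0 - y| => ar br.
  (* At least one of the weights [1 - t] and [t] is positive; the case split selects it, so that the
     convex combination stays strictly below [r]. *)
  have [t2|t2] := lerP t (1 / 2).
    have : 0 < (1 - t) * (r - b) by rewrite mulr_gt0//; lra.
    have : 0 <= t * (r - a) by rewrite mulr_ge0//; lra.
    lra.
  have : 0 <= (1 - t) * (r - b) by rewrite mulr_ge0//; lra.
  have : 0 < t * (r - a) by rewrite mulr_gt0//; lra.
  lra.
have dh t : is_diff t h (fun s => s *: (x - y)).
  have := is_diffD (is_diff_cst y t) (is_diff_scalel t (x - y)).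
  by rewrite add0r.
have dfh (t : R) : 0 <= t <= 1 -> is_derive t 1 (f \o h) ('d f (h t) (x - y)).
  move=> t01; have dfht := df _ (hr _ t01).
  have dfht' : differentiable (f \o h) t by exact: differentiable_comp.
  apply: DeriveDef; first exact: diff_derivable.
  by rewrite deriveE// diff_comp//= diff_val scale1r.
have [||c c01] := @MVT_segment _ (f \o h) (fun t => 'd f (h t) (x - y)) 0 1 ler01.
- by move=> t; rewrite in_itv/= => /andP[t0 t1]; apply: dfh; rewrite !ltW.
- apply: derivable_within_continuous => t; rewrite in_itv/= => t01.
  by have [] := dfh t t01.
have {}c01 : 0 <= c <= 1 by move: c01; rewrite in_itv.
rewrite subr0 mulr1 /= /h scale1r scale0r addr0 (addrC y) subrK => ->.
exists (h c); first exact: hr.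
by rewrite diff_partial//; exact/df/hr.
Qed.

Lemma lipschitz_continuous_at (R : realType) (V W : normedModType R) (g : V -> W) x K :
  0 <= K -> (\forall y \near x, `|g y - g x| <= K * `|y - x|) -> {for x, continuous g}.
Proof.
move=> K0 gK; apply/(@cvgrPdist_lt _ _ _ (nbhs x)) => s s0.
(* [K + 1] keeps the denominator positive when [K] is zero. *)
have sK : 0 < s / (K + 1) by rewrite divr_gt0//; lra.
have := nbhsx_ballx x _ sK; rewrite -ball_normE /=.
apply: filterS2 gK => y gy xy.
rewrite distrC (le_lt_trans gy)//.
rewrite (@le_lt_trans _ _ ((K + 1) * `|y - x|))//; first by rewrite ler_wpM2r// lerDl.
have K10 : 0 < K + 1 by rewrite ltr_wpDl.
by move: xy; rewrite /= distrC ltr_pdivlMr// mulrC.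
Qed.

(** * Functions affine in the multipliers *)

Section FlamCalculus.
Variables (R : realType) (m n : nat).
Implicit Types (C : 'I_m -> 'rV[R]_n -> R) (H : 'rV[R]_n -> R).

Lemma differentiable_Flam C H (l : 'rV[R]_m) x : differentiable H x ->
  (forall a, differentiable (C a) x) -> differentiable (Flam C H l) x.
Proof.
move=> dH dC; have -> : Flam C H l = H + \sum_(a < m) l 0 a *: C a.
  by apply/funext => y; rewrite /Flam /GRing.add/= fct_sumE.
by apply: differentiableD => //; apply: differentiable_sum => a; exact: differentiableZ.
Qed.

(** Differentiating in x preserves the shape [Flam], so the entries of the gradient and of the
    Hessian of F_l are again of this form. *)
Lemma partial_Flam C H (l : 'rV[R]_m) (i : 'I_n) x : differentiable H x ->
  (forall a, differentiable (C a) x) ->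
  partial i (Flam C H l) x = Flam (fun a => partial i (C a)) (partial i H) l x.
Proof.
move=> dH dC; have -> : Flam C H l = H + \sum_(a < m) l 0 a *: C a.
  by apply/funext => y; rewrite /Flam /GRing.add/= fct_sumE.
have dZ a : derivable (l 0 a *: C a) x (evec R i).
  by apply: derivableZ; exact: diff_derivable.
rewrite /partial deriveD; [|exact: diff_derivable|exact: derivable_sum].
rewrite derive_sum//; congr (_ + _); apply: eq_bigr => a _.
by rewrite deriveZ//; exact: diff_derivable.
Qed.

Lemma FlamB C H (l l' : 'rV[R]_m) x :
  Flam C H l x - Flam C H l' x = \sum_(a < m) (l - l') 0 a * C a x.
Proof.
rewrite /Flam opprD addrACA subrr add0r -sumrB.
by apply: eq_bigr => a _; rewrite !mxE mulrBl.
Qed.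

Lemma Ck_Flam_comp k (V : set 'rV[R]_m) (B : set 'rV[R]_n) C H
    (h : 'rV[R]_m -> 'rV[R]_n) : open V -> (forall l, V l -> B (h l)) ->
  (forall j, Ck k V (fun l => h l 0 j)) -> Ck k B H -> (forall a, Ck k B (C a)) ->
  Ck k V (fun l => Flam C H l (h l)).
Proof.
move=> oV VB ch cH cC; apply: CkD => //; first exact: Ck_comp cH.
apply: Ck_sum => // a _; apply: CkM => //; first exact: Ck_coord.
exact: Ck_comp (cC a).
Qed.

Lemma continuous_Flam C H l x : {for x, continuous H} ->
  (forall a, {for x, continuous (C a)}) ->
  {for (l, x), continuous (fun z : 'rV[R]_m * 'rV[R]_n => Flam C H z.1 z.2)}.
Proof.
move=> cH cC.
have cs (f : 'rV[R]_n -> R) : {for x, continuous f} ->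
    {for (l, x), continuous (fun z : 'rV[R]_m * 'rV[R]_n => f z.2)}.
  by move=> cf; exact: (@cvg_comp _ _ _ snd f _ (nbhs x) _ cvg_snd cf).
apply: continuousD; first exact: cs.
apply: cvg_big; first exact: add_continuous.
move=> a _; apply: continuousM; last exact: cs.
exact: (@cvg_comp _ _ _ fst _ _ (nbhs l) _ cvg_fst (@coord_continuous _ _ _ 0 a l)).
Qed.

End FlamCalculus.

(** * An implicit function theorem for systems affine in the parameter *)

Section ParametricSystem.
Variables (R : realType) (m n : nat).
Variables (Q : 'I_n -> 'I_m -> 'rV[R]_n -> R) (P : 'I_n -> 'rV[R]_n -> R).

(** For [P j] equal to [partial j H] and [Q j a] equal to [partial j (C a)], this is the gradient of
    F_l. *)
Definition Fsystem (l : 'rV[R]_m) x : 'rV[R]_n := \row_j Flam (Q j) (P j) l x.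

(* Row-vector convention: the differential of [Fsystem l] is [u |-> u *m J]. *)
Definition Fjacobian (l : 'rV[R]_m) x : 'M[R]_n :=
  \matrix_(i, j) Flam (fun a => partial i (Q j a)) (partial i (P j)) l x.

(** The derivative of [Fsystem] in [l], which is independent of [l] because the system is affine in
    [l]. *)
Definition Fcoef x : 'M[R]_(m, n) := \matrix_(a, j) Q j a x.

End ParametricSystem.

Section ImplicitFunction.
Variables (R : realType) (m n : nat) (Omega : set 'rV[R]_n).
Variables (Q : 'I_n -> 'I_m -> 'rV[R]_n -> R) (P : 'I_n -> 'rV[R]_n -> R).
Hypothesis openOmega : open Omega.
Hypothesis smoothP : forall j, smooth Omega (P j).
Hypothesis smoothQ : forall j a, smooth Omega (Q j a).

Local Notation G := (Fsystem Q P).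
Local Notation J := (Fjacobian Q P).
Local Notation D := (Fcoef Q).

Let dP j x : Omega x -> differentiable (P j) x.
Proof. by have [+ _] := smoothP j 1; exact. Qed.

Let dQ j a x : Omega x -> differentiable (Q j a) x.
Proof. by have [+ _] := smoothQ j a 1; exact. Qed.

Lemma FsystemB l l' x : G l x - G l' x = (l - l') *m D x.
Proof.
by apply/rowP => j; rewrite !mxE FlamB; apply: eq_bigr => a _; rewrite [D x _ _]mxE.
Qed.

Lemma Fjacobian_continuous l x : Omega x ->
  {for (l, x), continuous (fun z : 'rV[R]_m * 'rV[R]_n => J z.1 z.2)}.
Proof.
move=> Ox; apply: continuous_mx => i j.
have -> : (fun z : 'rV[R]_m * 'rV[R]_n => J z.1 z.2 i j) =
  (fun z => Flam (fun a => partial i (Q j a)) (partial i (P j)) z.1 z.2).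
  by apply/funext => z; rewrite mxE.
apply: continuous_Flam => [|a].
  by have [_] := smoothP j 1; apply.
by have [_] := smoothQ j a 1; apply.
Qed.

(** The mean value theorem is applied to each component. The intermediate point varies with the
    component, which is harmless because [c] bounds [J l z - M] on the whole ball. *)
Lemma Fsystem_estimate l (x0 : 'rV[R]_n) r (M : 'M[R]_n) c : 0 <= c ->
  (forall z, `|x0 - z| < r -> Omega z /\ `|J l z - M| <= c) ->
  forall x y, `|x0 - x| < r -> `|x0 - y| < r ->
  `|G l x - G l y - (x - y) *m M| <= n%:R * c * `|x - y|.
Proof.
move=> c0 hz x y xr yr; apply: mx_norm_le => [|i0 j]; first by rewrite !mulr_ge0.
rewrite ord1 !mxE.
have [|z zr ->] := mean_value_row (f := Flam (Q j) (P j) l) _ xr yr.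
  move=> z /hz[Oz _].
  by apply: differentiable_Flam => [|a]; [exact: dP|exact: dQ].
have [Oz Jz] := hz z zr.
rewrite -sumrB (le_trans (ler_norm_sum _ _ _))//.
rewrite (le_trans (ler_sum _ (G := fun=> c * `|x - y|) _))//; last first.
  by rewrite sumr_const card_ord -mulrA mulr_natl.
move=> i _; rewrite -mulrBr normrM mulrC ler_pM//; last exact: ler_entry_norm.
rewrite (le_trans _ Jz)// (le_trans _ (ler_entry_norm _ i j))// !mxE.
by rewrite partial_Flam// => [|a]; [exact: dP|exact: dQ].
Qed.

(* From [G l (g l) = 0], [g l - g l1 + (l - l1) *m D *m J^-1] is [J^-1] applied
   to the Taylor remainder of [G l1] plus [(l - l1) *m (D (g l1) - D (g l))]. *)
Lemma solution_is_diff (g : 'rV[R]_m -> 'rV[R]_n) (V : set 'rV[R]_m) l1 K :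
  open V -> V l1 -> 0 <= K ->
  (forall l, V l -> Omega (g l) /\ G l (g l) = 0) ->
  (forall l, V l -> `|g l - g l1| <= K * `|l - l1|) ->
  J l1 (g l1) \in unitmx ->
  is_diff l1 g (fun u => u *m (- D (g l1) *m invmx (J l1 (g l1)))).
Proof.
move=> oV Vl1 K0 gV gL uJ; set x1 := g l1; set S := J l1 x1.
have Ox1 : Omega x1 by have [] := gV _ Vl1.
set N := - D x1 *m invmx S.
apply: (@differentiable_epsP _ _ _ g l1 (mulmxr N : {linear _ -> _})).
  exact: mulmxr_continuous.
move=> e e0; set c := `|invmx S|; have c0 : 0 <= c by rewrite /c.
(* [k] is one more than the constant collected in the final estimate, which thus becomes
   [(k - 1) / k * e]; the added 1 also keeps [k] positive. *)
pose k : R := n%:R * (n%:R * K + m%:R) * c + 1.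
have k0 : 0 < k by rewrite ltr_wpDl// mulr_ge0// mulr_ge0// addr_ge0// mulr_ge0//.
pose e1 := e / k; have e10 : 0 < e1 by rewrite divr_gt0.
have /nbhs_ballP[r r0 hr] : \forall z \near x1, Omega z /\ `|J l1 z - S| <= e1.
  apply: filterI; first exact: open_nbhs_nbhs.
  have cJ : {for x1, continuous (fun z => J l1 z)}.
    apply: (@continuous2_cvg _ _ _ _ (nbhs x1) _ (fun=> l1) id J l1 x1).
    - exact: Fjacobian_continuous.
    - exact: cvg_cst.
    - exact: cvg_id.
  have /cvgrPdist_le/(_ _ e10) := cJ; apply: filterS => z.
  by rewrite distrC.
have near_V : \forall l \near l1, V l by exact: open_nbhs_nbhs.
have cg : {for l1, continuous g}.
  by apply: (lipschitz_continuous_at K0); apply: filterS near_V.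
have cD : {for x1, continuous D}.
  apply: continuous_mx => a j.
  have -> : (fun y => D y a j) = Q j a by apply/funext => y; rewrite mxE.
  exact: smoothQ j a 0 _ Ox1.
have near_r : \forall l \near l1, `|x1 - g l| < r.
  exact: ((@cvgrPdist_lt _ _ _ (nbhs l1) _ g x1).1 cg).
have near_D : \forall l \near l1, `|D x1 - D (g l)| <= e1.
  apply: ((@cvgrPdist_le _ _ _ (nbhs l1) _ (D \o g) (D x1)).1 _ _ e10).
  exact: continuous_comp.
apply: filterS3 near_r near_D near_V => l gr De Vl.
have [Ogl Ggl] := gV _ Vl; have [_ Ggl1] := gV _ Vl1.
have {hr} hr z : `|x1 - z| < r -> Omega z /\ `|J l1 z - S| <= e1.
  by move=> zr; apply: hr; rewrite -ball_normE.
have x1r : `|x1 - x1| < r by rewrite subrr normr0.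
have Ge := Fsystem_estimate (ltW e10) hr gr x1r.
have E : g l - x1 - (l - l1) *m N =
    ((l - l1) *m (D x1 - D (g l)) - (G l1 (g l) - G l1 x1 - (g l - x1) *m S)) *m invmx S.
  have -> : G l1 (g l) = - ((l - l1) *m D (g l)).
    by rewrite -FsystemB Ggl sub0r opprK.
  rewrite Ggl1 subr0 mulmxBr opprD !opprK subrKA (mulmxDl _ _ (invmx S)) mulmxK//.
  by rewrite /N mulNmx mulmxN opprK mulmxA addrC.
rewrite [X in X <= _]/=.
rewrite E (le_trans (ler_norm_mulrowmx _ _))// -/c.
have h1 := ler_norm_mulrowmx (l - l1) (D x1 - D (g l)).
have h2 := gL _ Vl.
rewrite (@le_trans _ _
  (n%:R * (m%:R * `|l - l1| * e1 + n%:R * e1 * (K * `|l - l1|)) * c))//.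
  rewrite ler_wpM2r// ler_wpM2l// (le_trans (ler_normB _ _))// lerD//.
    by rewrite (le_trans h1)// ler_wpM2l// mulr_ge0.
  by rewrite (le_trans Ge)// ler_wpM2l// mulr_ge0// ltW.
have -> : n%:R * (m%:R * `|l - l1| * e1 + n%:R * e1 * (K * `|l - l1|)) * c =
  (k - 1) / k * e * `|l - l1| by rewrite /e1 /k; ring.
rewrite ler_wpM2r// ger_pMl// ler_pdivrMr// mul1r; lra.
Qed.

(** Zeros of [G l] are the fixed points of [T l x = x - G l x *m invmx J0], to which
    [parametric_contraction] applies. The neighborhood [U] carries further conditions that the
    solutions have to satisfy. *)
Lemma local_solution (U : set 'rV[R]_n) l0 x0 :
  nbhs x0 U -> Omega x0 -> G l0 x0 = 0 -> J l0 x0 \in unitmx ->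
  exists d (g : 'rV[R]_m -> 'rV[R]_n) K, [/\ 0 < d, 0 <= K, g l0 = x0,
    forall l, `|l0 - l| < d -> [/\ U (g l), Omega (g l) & G l (g l) = 0] &
    forall l l', `|l0 - l| < d -> `|l0 - l'| < d ->
      `|g l - g l'| <= K * `|l - l'|].
Proof.
move=> Ux0 Ox0 G0 uJ; set J0 := J l0 x0.
set b := `|invmx J0|; have b0 : 0 <= b by rewrite /b.
pose k : R := n%:R * n%:R * b + 1.
have k0 : 0 < k by rewrite ltr_wpDl// !mulr_ge0.
(* If [J] stays within [c] of [J0], the contraction factor of [T l] is [(k - 1) / (2 * k)], below
   one half. *)
pose c := (2 * k)^-1; have c0 : 0 < c by rewrite invr_gt0 mulr_gt0.
pose q := `|D x0| + 1; have q0 : 0 <= q by rewrite addr_ge0.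
have near_x0 : \forall x \near x0, [/\ U x, Omega x & `|D x| <= q].
  have cD : {for x0, continuous D}.
    apply: continuous_mx => a j.
    have -> : (fun y => D y a j) = Q j a by apply/funext => y; rewrite mxE.
    exact: smoothQ j a 0 _ Ox0.
  have near_D : \forall x \near x0, `|D x0 - D x| <= 1.
    exact: ((@cvgrPdist_le _ _ _ (nbhs x0) _ D (D x0)).1 cD).
  have near_O : \forall x \near x0, Omega x by exact: open_nbhs_nbhs.
  have near_U : \forall x \near x0, U x by [].
  apply: filterS3 near_U near_O near_D => x Ux Ox Dx; split=> //.
  rewrite -(subrK (D x0) (D x)) /q (le_trans (ler_normD _ _))//.
  by rewrite addrC lerD2l distrC.
have [s s0 hs] : exists2 s, 0 < s & forall l x, `|l0 - l| < s -> `|x0 - x| < s ->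
    [/\ U x, Omega x, `|D x| <= q & `|J l x - J0| <= c].
  have near_J : \forall z \near (l0, x0), `|J0 - J z.1 z.2| <= c.
    apply: ((@cvgrPdist_le _ _ _ (nbhs (l0, x0)) _ (fun z => J z.1 z.2) J0).1 _ _ c0).
    exact: Fjacobian_continuous.
  have /nbhs_ballP[s1 s10 hs1] := near_J.
  have /nbhs_ballP[s2 s20 hs2] := near_x0.
  exists (Num.min s1 s2); first by rewrite lt_min; apply/andP.
  move=> l x; rewrite !lt_min => /andP[l1 _] /andP[x1 x2].
  have [|Ux Ox Dx] := hs2 x; first by rewrite -ball_normE.
  split=> //; rewrite distrC; apply: (hs1 (l, x)).
  by split; rewrite -ball_normE.
(* Lipschitz constant of [T] in the parameter: [FsystemB] gives an exact difference, with [D]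
   bounded by [q] and [invmx J0] of norm [b]. *)
pose K := n%:R * (m%:R * q) * b.
have K0 : 0 <= K by rewrite !mulr_ge0.
(* Halving [s] puts the closed ball of radius [r] inside the open ball where the estimates hold. *)
pose r := s / 2; have r0 : 0 < r by rewrite divr_gt0.
pose d := Num.min s (r / 2 / (K + 1)).
have d0 : 0 < d by rewrite lt_min s0 !divr_gt0//; lra.
have Kd : K * d <= r / 2.
  rewrite (@le_trans _ _ ((K + 1) * (r / 2 / (K + 1))))//; last first.
    by rewrite mulrC divfK// gt_eqF//; lra.
  by rewrite ler_pM ?ge_min ?lexx ?orbT// ?lerDl// ltW.
pose T l x := x - G l x *m invmx J0.
have ds p : `|l0 - p| < d -> `|l0 - p| < s by rewrite lt_min => /andP[].
have rs x : `|x0 - x| <= r -> `|x0 - x| < s.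
  by move=> /le_lt_trans; apply; rewrite /r; lra.
have [|p x y pd xr yr|p p' x pd pd' xr|g [g0 gT gL]] :=
    parametric_contraction d0 r0 K0 Kd (T := T) (p0 := l0) (x0 := x0).
- by rewrite /T G0 mul0mx subr0.
- have -> : T p x - T p y = - ((G p x - G p y - (x - y) *m J0) *m invmx J0).
    rewrite mulmxBl mulmxK// mulmxBl /T.
    by apply/rowP => i; rewrite !mxE; ring.
  rewrite normrN (le_trans (ler_norm_mulrowmx _ _))// -/b.
  rewrite (@le_trans _ _ (n%:R * (n%:R * c * `|x - y|) * b))//.
    rewrite ler_wpM2r// ler_wpM2l//; apply: Fsystem_estimate (rs x xr) (rs y yr).
      exact: ltW.
    by move=> z zs; have [] := hs p z (ds p pd) zs.
  have -> : n%:R * (n%:R * c * `|x - y|) * b = (k - 1) / k * (2^-1 * `|x - y|).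
    by rewrite /c /k invfM; ring.
  by rewrite ler_piMl// ler_pdivrMr// mul1r gerBl.
- have -> : T p x - T p' x = ((p' - p) *m D x) *m invmx J0.
    rewrite -FsystemB mulmxBl /T; apply/rowP => i; rewrite !mxE; ring.
  have [_ _ Dx _] := hs p x (ds p pd) (rs x xr).
  rewrite (le_trans (ler_norm_mulrowmx _ _))// -/b.
  have -> : K * `|p - p'| = n%:R * (m%:R * `|p' - p| * q) * b.
    by rewrite /K distrC; ring.
  rewrite ler_wpM2r// ler_wpM2l// (le_trans (ler_norm_mulrowmx _ _))//.
  by rewrite ler_wpM2l// mulr_ge0.
exists d, g, (2 * K); split=> //; first by rewrite mulr_ge0.
move=> l ld; have [gr gE] := gT l ld.
have [Ug Og _ _] := hs l (g l) (ds l ld) (rs _ gr); split=> //.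
(* The fixed point equation says that [G l (g l) *m invmx J0] vanishes; multiplying by [J0] gives
   the zero of [G l]. *)
move: gE; rewrite /T => /eqP; rewrite subr_eq addrC -subr_eq subrr => /eqP GB.
by rewrite -[LHS](mulmxKV uJ) -GB mul0mx.
Qed.

(** The Lipschitz solution is differentiable with derivative [- D (g l) *m invmx (J l (g l))]. This
    expression is C^k as soon as [g] is, so [g] gains one order at each step. *)
Lemma implicit_function (U : set 'rV[R]_n) l0 x0 :
  nbhs x0 U -> Omega x0 -> G l0 x0 = 0 -> J l0 x0 \in unitmx ->
  exists (V : set 'rV[R]_m) (g : 'rV[R]_m -> 'rV[R]_n),
    [/\ open V, V l0, smooth_map V g, g l0 = x0 &
      forall l, V l ->
        [/\ U (g l), Omega (g l), G l (g l) = 0 & J l (g l) \in unitmx]].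
Proof.
move=> Ux0 Ox0 G0 uJ.
have [d [g [K [d0 K0 gl0 gP gL]]]] := local_solution Ux0 Ox0 G0 uJ.
have ballE (e : R) l : ball l0 e l = (`|l0 - l| < e) :> Prop by rewrite -ball_normE.
have Og l : ball l0 d l -> Omega (g l) by rewrite ballE => /gP[].
(* [W] is left free: the claim is used on the ball of radius [d] for continuity of the determinant,
   then on the smaller ball of radius [e] in the induction. *)
have CkJ k W : open W -> W `<=` ball l0 d ->
    (forall j, Ck k W (fun l => g l 0 j)) ->
    forall i j, Ck k W (fun l => J l (g l) i j).
  move=> oW Wd cg i j.
  have cF : Ck k W (fun l => Flam (fun a => partial i (Q j a)) (partial i (P j)) l (g l)).
    apply: (@Ck_Flam_comp _ _ _ _ _ Omega) => //.
    - by move=> l /Wd/Og.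
    - by have [_] := smoothP j k.+1; exact.
    - by move=> a; have [_] := smoothQ j a k.+1; exact.
  by apply: Ck_ext cF => // l _; rewrite mxE.
have cg j : Ck 0 (ball l0 d) (fun l => g l 0 j).
  move=> l ld.
  have cgl : {for l, continuous g}.
    apply: (lipschitz_continuous_at K0).
    apply: (@filterS _ (nbhs l) _ (ball l0 d)).
      by move=> l'; rewrite ballE => l'd; apply: gL => //; rewrite -ballE.
    by apply: open_nbhs_nbhs; split=> //; exact: ball_open.
  exact: (@continuous_comp _ _ _ g (fun u : 'rV[R]_n => u 0 j) l cgl
    (@coord_continuous _ _ _ 0 j (g l))).
have cdet : Ck 0 (ball l0 d) (fun l => \det (J l (g l))).
  by apply: Ck_det; [exact: ball_open|apply: CkJ => //; exact: ball_open].
have ld0 : ball l0 d l0 by exact: ballxx.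
(* Shrinking the ball keeps the Jacobian invertible at every solution, by continuity of its
   determinant. *)
have [e e0 he] : exists2 e, 0 < e & forall l, ball l0 e l ->
    ball l0 d l /\ J l (g l) \in unitmx.
  have near_det : \forall l \near l0, \det (J l (g l)) != 0.
    apply: (@cvgr_neq0 _ _ _ (nbhs l0) _ _ _ (cdet l0 ld0)).
    by move: uJ; rewrite gl0 unitmxE unitfE.
  have near_d : \forall l \near l0, ball l0 d l by exact: nbhsx_ballx.
  have /nbhs_ballP[e e0 he] : \forall l \near l0,
      ball l0 d l /\ \det (J l (g l)) != 0 by exact: filterI.
  by exists e => // l /he[ld dl]; rewrite unitmxE unitfE.
have oe := ball_open l0 e.
exists (ball l0 e), g; split=> //; first exact: ballxx; last first.
  by move=> l /he[ld ul]; move: ld; rewrite ballE => /gP[].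
have gdiff l : ball l0 e l ->
    is_diff l g (fun u => u *m (- D (g l) *m invmx (J l (g l)))).
  move=> le; have [ld ul] := he l le.
  apply: (solution_is_diff (ball_open l0 d)) K0 _ _ ul => // l'; rewrite ballE.
    by case/gP.
  by move=> l'd; apply: gL => //; rewrite -ballE.
have dg j l : ball l0 e l -> differentiable (fun l => g l 0 j) l.
  move=> le; have [dgl _] := gdiff l le.
  apply: (@differentiable_comp _ _ _ _ g (fun u : 'rV[R]_n => u 0 j)) => //.
  exact: differentiable_coord.
have pg i j l : ball l0 e l -> partial i (fun l => g l 0 j) l =
    (- D (g l) *m invmx (J l (g l))) i j.
  move=> le; have [dgl dE] := gdiff l le.
  have := derive_mx (diff_derivable (v := evec R i) dgl).
  by rewrite deriveE// dE -rowE => /rowP/(_ j); rewrite !mxE.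
(* The induction on [k] treats all components together, since each partial of one component involves
   all of [g]. *)
move=> j k; elim: k j => [|k IH] j.
  by move=> l le; apply: differentiable_continuous; exact: dg.
split=> [l|i]; first exact: dg.
have cN : forall i j, Ck k (ball l0 e) (fun l => (- D (g l) *m invmx (J l (g l))) i j).
  apply: Ck_mulmx => // [a b|].
    have cQ : Ck k (ball l0 e) (fun l => Q b a (g l)).
      by apply: Ck_comp (smoothQ b a k) => // l /he[/Og].
    by apply: Ck_ext (CkN oe cQ) => // l _; rewrite !mxE.
  apply: Ck_invmx => // [l /he[]//|].
  by apply: CkJ => // l /he[].
by apply: Ck_ext (cN i j) => // l le; rewrite pg.
Qed.

End ImplicitFunction.

(** * Multipliers, Hessians and equilibria *)

Section RegularEquilibria.
Variables (R : realType) (m n : nat).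
Implicit Types (C : 'I_m -> 'rV[R]_n -> R) (H : 'rV[R]_n -> R).

Lemma mulmx_gradsC C (l : 'rV[R]_m) x :
  l *m gradsC C x = \sum_(a < m) l 0 a *: grad (C a) x.
Proof.
rewrite mulmx_sum_row; apply: eq_bigr => a _; congr (_ *: _).
by apply/rowP => j; rewrite !mxE.
Qed.

Lemma is_multiplierE C H (l : 'rV[R]_m) x : is_multiplier C H l x <->
  Fsystem (fun j a => partial j (C a)) (fun j => partial j H) l x = 0.
Proof.
rewrite /is_multiplier; set u := Fsystem _ _ _ _.
suff -> : u = grad H x + \sum_(i < m) l 0 i *: grad (C i) x by [].
apply/rowP => j; rewrite !mxE summxE; congr (_ + _).
by apply: eq_bigr => a _; rewrite !mxE.
Qed.

Lemma smooth_partial (A : set 'rV[R]_n) (f : 'rV[R]_n -> R) i :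
  smooth A f -> smooth A (partial i f).
Proof. by move=> sf k; have [_] := sf k.+1; exact. Qed.

(** The transpose comes from the row-vector convention: [Fjacobian] has the differentiation index as
    its row index, [hess] as its column index. *)
Lemma hess_Flam (A : set 'rV[R]_n) C H (l : 'rV[R]_m) x : open A -> A x ->
  smooth A H -> (forall a, smooth A (C a)) ->
  hess (Flam C H l) x =
  (Fjacobian (fun j a => partial j (C a)) (fun j => partial j H) l x)^T.
Proof.
move=> oA Ax sH sC; apply/matrixP => i j; rewrite !mxE.
have dA f y : smooth A f -> A y -> differentiable f y.
  by move=> sf; have [+ _] := sf 1; exact.
have nA : \forall y \near x, A y by exact: open_nbhs_nbhs.
rewrite (@near_eq_partial _ _ _ _ (Flam (fun a => partial i (C a)) (partial i H) l)).
  by rewrite partial_Flam// => [|a]; apply: dA => //; exact: smooth_partial.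
by apply: filterS nA => y Ay; rewrite partial_Flam// => [|a]; exact: dA.
Qed.

(** The nonzero row (l, 1) annihilates the stacked gradients, hence also every selection of columns,
    so all maximal minors vanish. *)
Lemma is_multiplier_wedge C H (l : 'rV[R]_m) x : is_multiplier C H l x ->
  wedge_eq0 (col_mx (gradsC C x) (grad H x)).
Proof.
move=> mult f; apply/eqP/det0P; exists (row_mx l 1%:M).
  apply/eqP => /rowP/(_ (rshift m 0)); rewrite row_mxEr !mxE eqxx.
  exact/eqP/oner_neq0.
have -> : row_mx l 1%:M *m colsub f (col_mx (gradsC C x) (grad H x)) =
    colsub f (row_mx l 1%:M *m col_mx (gradsC C x) (grad H x)).
  by apply/rowP => j; rewrite !mxE; apply: eq_bigr => a _; rewrite [colsub _ _ _ _]mxE.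
rewrite mul_row_col mul1mx mulmx_gradsC addrC mult.
by apply/rowP => j; rewrite !mxE.
Qed.

Lemma det_castmx_eq0 (k q : nat) (e : k = q) (M : 'M[R]_(k, q)) (v : 'rV[R]_k) :
  v != 0 -> v *m M = 0 -> \det (castmx (e, erefl q) M) = 0.
Proof.
by case: q / e M => M v0 vM; rewrite castmx_id; apply/eqP/det0P; exists v.
Qed.

End RegularEquilibria.

(** The row (l, 0, 1), with 0 at the row [evec R i], is a nonzero left kernel vector of the Jacobian
    matrix for every [i]. *)
Lemma is_multiplier_vfX (R : realType) (m : nat) (nu : 'rV[R]_m.+2 -> R)
    (C : 'I_m -> 'rV[R]_m.+2 -> R) (H : 'rV[R]_m.+2 -> R) (l : 'rV[R]_m) x :
  is_multiplier C H l x -> vfX nu C H x = 0.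
Proof.
move=> mult; apply/rowP => i; rewrite !mxE /jacX.
rewrite (det_castmx_eq0 _ (v := row_mx l (row_mx 0 1%:M : 'rV_(1 + 1)))) ?mulr0//.
  apply/eqP => /rowP/(_ (rshift m (rshift 1 0))); rewrite !row_mxEr !mxE eqxx.
  exact/eqP/oner_neq0.
by rewrite !mul_row_col mul0mx add0r mul1mx mulmx_gradsC addrC.
Qed.

(** * The smooth family of equilibria through xe *)

Unset Implicit Arguments. Set Strict Implicit. Set Printing Implicit Defensive.

(* n = m.+2; C_1..C_{n-2} = C, C_{n-1} = H *)
Theorem theorem3p4 (R : realType) (m : nat) (Omega : set 'rV[R]_m.+2)
  (nu : 'rV[R]_m.+2 -> R) (C : 'I_m -> 'rV[R]_m.+2 -> R) (H : 'rV[R]_m.+2 -> R)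
  (xe : 'rV[R]_m.+2) (lame : 'rV[R]_m) :
  open Omega ->
  smooth Omega nu -> (forall i, smooth Omega (C i)) -> smooth Omega H ->
  regEq Omega nu C H xe ->
  vfX nu C H xe = 0 ->
  is_multiplier C H lame xe ->
  nondeg C H lame xe ->
  exists (V : set 'rV[R]_m) (U : set 'rV[R]_m.+2) (xbar : 'rV[R]_m -> 'rV[R]_m.+2),
    [/\ open V /\ V lame, open U /\ U `<=` Omega /\ U xe,
        smooth_map V xbar /\ (forall l, V l -> U (xbar l)), xbar lame = xe &
        forall l, V l ->
          [/\ regEq Omega nu C H (xbar l), vfX nu C H (xbar l) = 0,
              is_multiplier C H l (xbar l) & nondeg C H l (xbar l)]].
Proof.
move=> openOmega snu sC sH [Oxe [nuxe [wC _]]] _ mult nd.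
(* Fixing one nonvanishing minor at [xe] turns the wedge condition into an open condition that
   suffices nearby. *)
have [f minor] : exists f, \det (colsub f (gradsC C xe)) <> 0 by apply/existsNP.
pose U : set 'rV[R]_m.+2 := [set x | nu x != 0 /\ \det (colsub f (gradsC C x)) != 0].
have Uxe : nbhs xe U.
  apply: filterI.
    by apply: (@cvgr_neq0 _ _ _ (nbhs xe) _ _ _ (snu 0%N xe Oxe)).
  have cdet : Ck 0 Omega (fun x => \det (colsub f (gradsC C x))).
    apply: Ck_det => // i j; apply: Ck_ext (smooth_partial (f j) (sC i) 0) => // x _.
    by rewrite !mxE.
  by apply: (@cvgr_neq0 _ _ _ (nbhs xe) _ _ _ (cdet xe Oxe)); exact/eqP.
have ndE l x : Omega x -> nondeg C H l x <->
    Fjacobian (fun j a => partial j (C a)) (fun j => partial j H) l x \in unitmx.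
  by move=> Ox; rewrite /nondeg (hess_Flam _ openOmega Ox)// det_tr unitmxE unitfE.
have sP j := smooth_partial j sH.
have sQ j a := smooth_partial j (sC a).
(* [U] is only known to be a neighborhood of [xe]; its interior is used so that the solutions stay
   in an open set. *)
have [V [g [oV Vl sg gl gP]]] := implicit_function openOmega sP sQ
  (nbhs_interior Uxe) Oxe ((is_multiplierE _ _ _ _).1 mult) ((ndE _ _ Oxe).1 nd).
exists V, (Omega `&` U°), g; split.
- by [].
- split; first by apply: openI; [exact: openOmega|exact: open_interior].
  split; first exact: subIsetl.
  by split; [exact: Oxe|exact: nbhs_singleton (nbhs_interior Uxe)].
- by split; [exact: sg|move=> l /gP[]].
- exact: gl.
move=> l /gP[/interior_subset[nugl minorgl] Ogl].
move=> /is_multiplierE multgl /(ndE _ _ Ogl) ndgl.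
split; [|exact: is_multiplier_vfX multgl|exact: multgl|exact: ndgl].
split; first exact: Ogl.
split; first exact: nugl.
split; last exact: is_multiplier_wedge multgl.
by move=> /(_ f) /eqP; rewrite (negPf minorgl).
Qed.
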